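(* Let $\mathcal{V}$ be a variety of left quasigroups. The following are equivalent: (i) $\mathcal{V}$ is congruence meet-semidistributive. (ii) $\mathcal{V}$ is congruence distributive. (iii) $\mathcal{V}$ is congruence arithmetic.
   Context: A left quasigroup is an algebra $(Q,*,\backslash)$ with two binary operations satisfying $x*(x\backslash y)\approx y\approx x\backslash(x*y)$; varieties and congruences are with respect to the signature $\{*,\backslash\}$. A variety is congruence meet-semidistributive if, for all congruences $\alpha,\beta,\gamma$ of any of its algebras, $\alpha\wedge\beta=\alpha\wedge\gamma$ implies $\alpha\wedge\beta=\alpha\wedge(\beta\vee\gamma)$. It is congruence distributive if the congruence lattice of each of its algebras is distributive. It is congruence arithmetic if it is congruence distributive and has a Mal'cev term (i.e. a ternary term $m$ with $m(x,y,y)\approx x\approx m(y,y,x)$; equivalently, it is congruence permutable). *)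

(* Defs.v *)
From Stdlib Require Import Relations FunctionalExtensionality.

(** The carrier is allowed to be empty; on an empty carrier all congruence
    conditions and identities below hold trivially. *)
Record leftQuasigroup : Type := LeftQuasigroup {
  carrier :> Type;
  mul : carrier -> carrier -> carrier;
  ldiv : carrier -> carrier -> carrier;
  mul_ldiv : forall x y, mul x (ldiv x y) = y;
  ldiv_mul : forall x y, ldiv x (mul x y) = y
}.

Arguments mul {_} _ _.
Arguments ldiv {_} _ _.
Arguments mul_ldiv {_} _ _.
Arguments ldiv_mul {_} _ _.

Definition is_hom (P Q : leftQuasigroup) (f : P -> Q) : Prop :=
  (forall x y, f (mul x y) = mul (f x) (f y)) /\
  (forall x y, f (ldiv x y) = ldiv (f x) (f y)).

Arguments is_hom {_ _} _.

Definition prod_lq (I : Type) (F : I -> leftQuasigroup) : leftQuasigroup.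
Proof.
refine (@LeftQuasigroup (forall i, F i)
  (fun x y i => mul (x i) (y i)) (fun x y i => ldiv (x i) (y i)) _ _).
- intros x y; apply functional_extensionality_dep; intro i; apply mul_ldiv.
- intros x y; apply functional_extensionality_dep; intro i; apply ldiv_mul.
Defined.

Arguments prod_lq {_} _.

(** Closure under homomorphic images, subalgebras and direct products.
    Subalgebras are taken up to isomorphism, as domains of embeddings; this
    loses nothing because closure under homomorphic images already implies
    closure under isomorphism. *)
Record is_variety (V : leftQuasigroup -> Prop) : Prop := {
  variety_image : forall (P Q : leftQuasigroup) (f : P -> Q),
    is_hom f -> (forall y, exists x, f x = y) -> V P -> V Q;
  variety_sub : forall (P Q : leftQuasigroup) (f : P -> Q),
    is_hom f -> (forall x y, f x = f y -> x = y) -> V Q -> V P;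
  variety_prod : forall (I : Type) (F : I -> leftQuasigroup),
    (forall i, V (F i)) -> V (prod_lq F)
}.

Record congruence (Q : leftQuasigroup) : Type := Congruence {
  cong_rel :> Q -> Q -> Prop;
  cong_equiv : equivalence Q cong_rel;
  cong_mul : forall x x' y y', cong_rel x x' -> cong_rel y y' ->
    cong_rel (mul x y) (mul x' y');
  cong_ldiv : forall x x' y y', cong_rel x x' -> cong_rel y y' ->
    cong_rel (ldiv x y) (ldiv x' y')
}.

Arguments cong_rel {_} _ _ _.
Arguments cong_equiv {_} _.
Arguments cong_mul {_} _ _ _ _ _ _ _.
Arguments cong_ldiv {_} _ _ _ _ _ _ _.

(** Congruences are compared extensionally, as sets of pairs. *)
Definition cong_le {Q : leftQuasigroup} (a b : congruence Q) : Prop :=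
  inclusion Q a b.

Definition cong_eq {Q : leftQuasigroup} (a b : congruence Q) : Prop :=
  same_relation Q a b.

Definition cong_meet {Q : leftQuasigroup} (a b : congruence Q) : congruence Q.
Proof.
refine (@Congruence Q (fun x y => a x y /\ b x y) _ _ _).
- destruct (cong_equiv a) as [ra ta sa], (cong_equiv b) as [rb tb sb].
  split.
  + intro x; split; [apply ra | apply rb].
  + intros x y z [? ?] [? ?]; split; [eapply ta | eapply tb]; eassumption.
  + intros x y [? ?]; split; [apply sa | apply sb]; assumption.
- intros x x' y y' [? ?] [? ?]; split; apply cong_mul; assumption.
- intros x x' y y' [? ?] [? ?]; split; apply cong_ldiv; assumption.
Defined.

(** The least congruence containing both arguments. *)
Definition cong_join {Q : leftQuasigroup} (a b : congruence Q) : congruence Q.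
Proof.
refine (@Congruence Q (fun x y => forall c : congruence Q,
  cong_le a c -> cong_le b c -> c x y) _ _ _).
- split.
  + intros x c _ _; apply (cong_equiv c).
  + intros x y z H H' c ac bc.
    destruct (cong_equiv c) as [_ t _]; exact (t _ _ _ (H c ac bc) (H' c ac bc)).
  + intros x y H c ac bc.
    destruct (cong_equiv c) as [_ _ s]; exact (s _ _ (H c ac bc)).
- intros x x' y y' H H' c ac bc; apply cong_mul; auto.
- intros x x' y y' H H' c ac bc; apply cong_ldiv; auto.
Defined.

Definition congruence_meet_semidistributive (V : leftQuasigroup -> Prop) : Prop :=
  forall Q : leftQuasigroup, V Q -> forall a b c : congruence Q,
    cong_eq (cong_meet a b) (cong_meet a c) ->
    cong_eq (cong_meet a b) (cong_meet a (cong_join b c)).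

Definition congruence_distributive (V : leftQuasigroup -> Prop) : Prop :=
  forall Q : leftQuasigroup, V Q -> forall a b c : congruence Q,
    cong_eq (cong_meet a (cong_join b c))
            (cong_join (cong_meet a b) (cong_meet a c)).

Inductive term (X : Type) : Type :=
| Var (x : X)
| Mul (s t : term X)
| LDiv (s t : term X).

Arguments Var {_} _.
Arguments Mul {_} _ _.
Arguments LDiv {_} _ _.

Fixpoint eval {X : Type} {Q : leftQuasigroup} (v : X -> Q) (t : term X) : Q :=
  match t with
  | Var x => v x
  | Mul s t => mul (eval v s) (eval v t)
  | LDiv s t => ldiv (eval v s) (eval v t)
  end.

Inductive var3 : Set := v1 | v2 | v3.

Definition eval3 {Q : leftQuasigroup} (m : term var3) (x y z : Q) : Q :=
  eval (fun i => match i with v1 => x | v2 => y | v3 => z end) m.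

Definition has_malcev_term (V : leftQuasigroup -> Prop) : Prop :=
  exists m : term var3, forall Q : leftQuasigroup, V Q -> forall x y : Q,
    eval3 m x y y = x /\ eval3 m y y x = x.

Definition congruence_arithmetic (V : leftQuasigroup -> Prop) : Prop :=
  congruence_distributive V /\ has_malcev_term V.

(* Main.v *)
Require Import Defs.
From Stdlib Require Import Relations Classical ClassicalEpsilon List.

(** The orbits of the group generated by the left translations of a left
    quasigroup are the classes of a congruence whose quotient satisfies
    [x * y = y].  On such a quotient every equivalence is a congruence, so a
    meet-semidistributive variety contains no nontrivial one.  Hence the free
    generators [x], [y] lie in one orbit: [y = h_{x,y}(x)] with [h_{x,y}] a
    composition of left translations by binary terms and their inverses, and
    [m(x,y,z) = h_{y,z}(h_{y,y}^{-1}(x))] is a Mal'cev term.  Permutability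
    gives modularity; then [b' = b \/ (a /\ c)] and [c' = c \/ (a /\ b)] both
    meet [a] in [(a /\ b) \/ (a /\ c)], and meet-semidistributivity applied to
    [a, b', c'] is distributivity. *)

(** * Congruence lattices and permutability *)

Section CongruenceLattice.

Context {Q : leftQuasigroup}.
Implicit Types a b c : congruence Q.

Lemma cong_refl a x : a x x.
Proof. apply (cong_equiv a). Qed.

Lemma cong_sym a x y : a x y -> a y x.
Proof. destruct (cong_equiv a) as [_ _ s]; apply s. Qed.

Lemma cong_trans a x y z : a x y -> a y z -> a x z.
Proof. destruct (cong_equiv a) as [_ t _]; apply t. Qed.

Lemma cong_join_l a b : cong_le a (cong_join a b).
Proof. intros x y H c ac _; exact (ac _ _ H). Qed.

Lemma cong_join_r a b : cong_le b (cong_join a b).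
Proof. intros x y H c _ bc; exact (bc _ _ H). Qed.

Lemma cong_join_least a b c :
  cong_le a c -> cong_le b c -> cong_le (cong_join a b) c.
Proof. intros ac bc x y H; exact (H c ac bc). Qed.

Lemma cong_eval a (X : Type) (t : term X) (v w : X -> Q) :
  (forall i, a (v i) (w i)) -> a (eval v t) (eval w t).
Proof.
intro H; induction t as [i | s IHs t IHt | s IHs t IHt]; simpl.
- apply H.
- apply cong_mul; assumption.
- apply cong_ldiv; assumption.
Qed.

Lemma cong_eval3 a (m : term var3) x x' y y' z z' :
  a x x' -> a y y' -> a z z' -> a (eval3 m x y z) (eval3 m x' y' z').
Proof. intros; apply cong_eval; intros []; assumption. Qed.

Section Permutable.

Context (m : term var3)
  (malcev : forall x y : Q, eval3 m x y y = x /\ eval3 m y y x = x).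

Definition cong_comp a b : Q -> Q -> Prop := fun x z => exists y, a x y /\ b y z.

Lemma cong_comp_comm a b x z : cong_comp a b x z -> cong_comp b a x z.
Proof.
(* [b] links x = m(x,z,z) to m(x,y,z), and [a] links m(x,y,z) to m(y,y,z) = z. *)
intros [y [ab bc]]; exists (eval3 m x y z); split.
- rewrite <- (proj1 (malcev x z)) at 1.
  apply cong_eval3; [apply cong_refl | apply cong_sym, bc | apply cong_refl].
- rewrite <- (proj2 (malcev z y)) at 2.
  apply cong_eval3; [exact ab | apply cong_refl | apply cong_refl].
Qed.

Definition comp_congruence a b : congruence Q.
Proof.
refine (@Congruence Q (cong_comp a b) _ _ _).
- split.
  + intro x; exists x; split; apply cong_refl.
  (* In the chain x a u b y a w b z the middle steps u b y a w are swapped to u a p b w. *)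
  + intros x y z [u [xu uy]] [w [yw wz]].
    destruct (cong_comp_comm b a u w) as [p [up pw]]; [now exists y |].
    exists p; split; eapply cong_trans; eassumption.
  + intros x y [u [xu uy]]; apply cong_comp_comm.
    exists u; split; apply cong_sym; assumption.
- intros x x' y y' [u [xu ux']] [w [yw wy']].
  exists (mul u w); split; apply cong_mul; assumption.
- intros x x' y y' [u [xu ux']] [w [yw wy']].
  exists (ldiv u w); split; apply cong_ldiv; assumption.
Defined.

Lemma cong_join_comp a b x z : cong_join a b x z -> cong_comp a b x z.
Proof.
intro H; apply (H (comp_congruence a b)).
- intros u w uw; exists w; split; [exact uw | apply cong_refl].
- intros u w uw; exists u; split; [apply cong_refl | exact uw].
Qed.

(** By permutability the join is reached through one intermediate [y], with x b y and (y,z) in a and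
    c. Since [a] contains (x,z) and (y,z), it contains (x,y) too. *)
Lemma cong_modular a b c :
  cong_le (cong_meet a (cong_join b (cong_meet a c)))
          (cong_join (cong_meet a b) (cong_meet a c)).
Proof.
intros x z [axz H]; destruct (cong_join_comp _ _ _ _ H) as [y [bxy [ayz cyz]]].
apply cong_trans with y.
- apply cong_join_l; split; [| exact bxy].
  exact (cong_trans _ _ _ _ axz (cong_sym _ _ _ ayz)).
- apply cong_join_r; split; assumption.
Qed.

End Permutable.

Lemma cong_meet_join_ge a b c :
  cong_le (cong_join (cong_meet a b) (cong_meet a c)) (cong_meet a (cong_join b c)).
Proof.
apply cong_join_least; intros x y [axy H]; (split; [exact axy |]).
- apply cong_join_l; exact H.
- apply cong_join_r; exact H.
Qed.

End CongruenceLattice.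

(** * Distributivity versus meet-semidistributivity *)

Lemma distributive_meet_semidistributive (V : leftQuasigroup -> Prop) :
  congruence_distributive V -> congruence_meet_semidistributive V.
Proof.
intros D Q VQ a b c [_ E]; split.
- intros x y [axy bxy]; split; [exact axy | apply cong_join_l; exact bxy].
- intros x y H; apply (D Q VQ) in H; revert x y H.
  apply cong_join_least; [intros x y H; exact H | exact E].
Qed.

Lemma malcev_meet_semidistributive_distributive (V : leftQuasigroup -> Prop) :
  has_malcev_term V -> congruence_meet_semidistributive V ->
  congruence_distributive V.
Proof.
intros [m Hm] SD Q VQ a b c; specialize (Hm Q VQ).
split; [| apply cong_meet_join_ge].
set (d := cong_join (cong_meet a b) (cong_meet a c)).
set (b' := cong_join b (cong_meet a c)).
set (c' := cong_join c (cong_meet a b)).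
assert (db : cong_le d (cong_meet a b')).
{ apply cong_join_least; intros x y H; (split; [exact (proj1 H) |]).
  - apply cong_join_l, H.
  - apply cong_join_r, H. }
assert (dc : cong_le d (cong_meet a c')).
{ apply cong_join_least; intros x y H; (split; [exact (proj1 H) |]).
  - apply cong_join_r, H.
  - apply cong_join_l, H. }
assert (bd : cong_le (cong_meet a b') d) by apply (cong_modular m Hm).
assert (cd : cong_le (cong_meet a c') d).
{ intros x y H; apply (cong_modular m Hm) in H; revert x y H.
  apply cong_join_least; [apply cong_join_r | apply cong_join_l]. }
destruct (SD Q VQ a b' c') as [_ E].
{ split; intros x y H; [apply dc, bd, H | apply db, cd, H]. }
(* [E] brings the meet of [a] with the join of [b'] and [c'] down to the meet of [a] and [b'], so
   only monotonicity of the join remains. *)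
intros x y [axy H]; apply bd, E; split; [exact axy |].
clear axy; revert x y H.
apply cong_join_least; intros x y H;
  [apply cong_join_l, cong_join_l, H | apply cong_join_r, cong_join_l, H].
Qed.

(** * Projection algebras *)

Definition projection_lq (X : Type) : leftQuasigroup :=
  @LeftQuasigroup X (fun _ y => y) (fun _ y => y)
    (fun _ _ => eq_refl) (fun _ _ => eq_refl).

(** The hypotheses say that [g] is a homomorphism to [projection_lq Y]; this is its kernel. *)
Definition fiber_congruence {Q : leftQuasigroup} {Y : Type} (g : Q -> Y)
  (g_mul : forall x y, g (mul x y) = g y)
  (g_ldiv : forall x y, g (ldiv x y) = g y) : congruence Q.
Proof.
refine (@Congruence Q (fun x y => g x = g y) _ _ _).
- split; [intro x; reflexivity | intros x y z; apply eq_trans | intros x y; apply eq_sym].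
- intros x x' y y' _ H; rewrite !g_mul; exact H.
- intros x x' y y' _ H; rewrite !g_ldiv; exact H.
Defined.

(** On the square of the two-element projection algebra, the two coordinates
    and their exclusive or are the atoms of a diamond of congruences. *)
Lemma meet_semidistributive_no_projection (V : leftQuasigroup -> Prop) :
  is_variety V -> congruence_meet_semidistributive V -> ~ V (projection_lq bool).
Proof.
intros hV SD VB.
pose (Q := prod_lq (fun _ : bool => projection_lq bool)).
assert (VQ : V Q) by (apply (variety_prod _ hV); intro; exact VB).
pose (a := @fiber_congruence Q bool (fun p => p true)
             (fun _ _ => eq_refl) (fun _ _ => eq_refl)).
pose (b := @fiber_congruence Q bool (fun p => p false)
             (fun _ _ => eq_refl) (fun _ _ => eq_refl)).
pose (c := @fiber_congruence Q bool (fun p => xorb (p true) (p false))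
             (fun _ _ => eq_refl) (fun _ _ => eq_refl)).
destruct (SD Q VQ a b c) as [_ E].
(* Any two of the first bit, the second bit and their exclusive or determine the third, so both
   meets are equality. *)
{ split; intros p q; simpl;
    destruct (p true), (p false), (q true), (q false); simpl; intros [? ?]; split; congruence. }
(* With the value at [true] written first, the points are p = (1,1), q = (1,0), r = (0,1): p b r c q
   and p a q, but not p b q. *)
pose (p := (fun _ => true) : Q).
pose (q := (fun i => i) : Q).
pose (r := negb : Q).
destruct (E p q) as [_ H]; [| discriminate H].
split; [reflexivity |].
apply cong_trans with r.
- apply cong_join_l; reflexivity.
- apply cong_join_r; reflexivity.
Qed.

(** * Free algebras *)

Lemma eval_prod (X I : Type) (F : I -> leftQuasigroup) (v : X -> prod_lq F)
  (t : term X) (i : I) : eval v t i = eval (fun x => v x i) t.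
Proof.
induction t as [x | s IHs t IHt | s IHs t IHt]; simpl;
  [reflexivity | |]; rewrite IHs, IHt; reflexivity.
Qed.

(** The product runs over pairs of terms, with one chosen algebra refuting each
    identity that fails in [V]: a product over all of [V] would be too large
    for the universe of [leftQuasigroup]. *)
Lemma free_valuation (V : leftQuasigroup -> Prop) (hV : is_variety V) (X : Type) :
  exists (P : leftQuasigroup) (g : X -> P), V P /\
    forall s t, eval g s = eval g t ->
    forall Q : leftQuasigroup, V Q -> forall v : X -> Q, eval v s = eval v t.
Proof.
pose (good := fun (st : term X * term X) (q : {Q : leftQuasigroup & X -> Q}) =>
  V (projT1 q) /\
  (eval (projT2 q) (fst st) = eval (projT2 q) (snd st) ->
   forall Q : leftQuasigroup, V Q -> forall v : X -> Q,
     eval v (fst st) = eval v (snd st))).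
assert (ex : forall st, exists q, good st q).
{ intros [s t].
  destruct (classic (forall Q : leftQuasigroup, V Q -> forall v : X -> Q,
                       eval v s = eval v t)) as [H | H].
  (* An identity valid in [V] needs no refutation, so any member of [V] serves; the empty product is
     always one. *)
  - pose (T := prod_lq (fun i : False => match i return leftQuasigroup with end)).
    assert (VT : V T) by (apply (variety_prod _ hV); intros []).
    exists (existT (fun Q : leftQuasigroup => X -> Q) T
              (fun _ (i : False) => match i with end)).
    split; [exact VT | intros _; exact H].
  - apply not_all_ex_not in H as [Q H]; apply imply_to_and in H as [VQ H].
    apply not_all_ex_not in H as [v H].
    exists (existT (fun Q : leftQuasigroup => X -> Q) Q v).
    split; [exact VQ | intro E; contradiction (H E)]. }
pose (q := fun st => proj1_sig (constructive_indefinite_description _ (ex st))).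
assert (Hq : forall st, good st (q st)).
{ intro st; apply (proj2_sig (constructive_indefinite_description _ (ex st))). }
exists (prod_lq (fun st => projT1 (q st))), (fun x st => projT2 (q st) x).
split.
- apply (variety_prod _ hV); intro st; apply Hq.
- intros s t E; apply (proj2 (Hq (s, t))).
  apply (f_equal (fun p => p (s, t))) in E; rewrite !eval_prod in E; exact E.
Qed.

Section Generated.

Context {X : Type} {P : leftQuasigroup} (g : X -> P).

(** Restricting to values of terms ensures that every left translation of the subalgebra is given by
    a term. *)
Definition generated_carrier : Type := {p : P | exists t, eval g t = p}.

Lemma generated_ext (p q : generated_carrier) : proj1_sig p = proj1_sig q -> p = q.
Proof. apply eq_sig_hprop; intros; apply proof_irrelevance. Qed.

Definition generated_lq : leftQuasigroup.
Proof.
refine (@LeftQuasigroup generated_carrier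
  (fun p q => exist _ (mul (proj1_sig p) (proj1_sig q)) _)
  (fun p q => exist _ (ldiv (proj1_sig p) (proj1_sig q)) _) _ _).
Unshelve.
3, 4: destruct p as [p [s Hs]], q as [q [t Ht]]; simpl.
3: exists (Mul s t); simpl; rewrite Hs, Ht; reflexivity.
3: exists (LDiv s t); simpl; rewrite Hs, Ht; reflexivity.
- intros x y; apply generated_ext, mul_ldiv.
- intros x y; apply generated_ext, ldiv_mul.
Defined.

Definition generator (x : X) : generated_lq :=
  exist _ (g x) (ex_intro _ (Var x) eq_refl).

Lemma generated_in_variety (V : leftQuasigroup -> Prop) :
  is_variety V -> V P -> V generated_lq.
Proof.
intros hV; apply (variety_sub _ hV _ _ (@proj1_sig _ _ : generated_lq -> P)).
- split; reflexivity.
- exact generated_ext.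
Qed.

End Generated.

(** * Words in left translations *)

(** A word encodes a composition of left translations ([true]) and inverses of
    left translations ([false]), the head of the list acting last. *)
Fixpoint act {Q : leftQuasigroup} (w : list (bool * Q)) (z : Q) : Q :=
  match w with
  | nil => z
  | (true, a) :: w => mul a (act w z)
  | (false, a) :: w => ldiv a (act w z)
  end.

Fixpoint act_inv {Q : leftQuasigroup} (w : list (bool * Q)) (z : Q) : Q :=
  match w with
  | nil => z
  | (true, a) :: w => act_inv w (ldiv a z)
  | (false, a) :: w => act_inv w (mul a z)
  end.

Fixpoint act_term {X : Type} (w : list (bool * term X)) (z : term X) : term X :=
  match w with
  | nil => z
  | (true, a) :: w => Mul a (act_term w z)
  | (false, a) :: w => LDiv a (act_term w z)
  end.

Fixpoint act_inv_term {X : Type} (w : list (bool * term X)) (z : term X) : term X :=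
  match w with
  | nil => z
  | (true, a) :: w => act_inv_term w (LDiv a z)
  | (false, a) :: w => act_inv_term w (Mul a z)
  end.

Definition eval_word {X : Type} {Q : leftQuasigroup} (v : X -> Q)
  (w : list (bool * term X)) : list (bool * Q) :=
  map (fun l => (fst l, eval v (snd l))) w.

Lemma act_act_inv (Q : leftQuasigroup) (w : list (bool * Q)) z :
  act w (act_inv w z) = z.
Proof.
revert z; induction w as [| [[] a] w IH]; intro z; simpl; [reflexivity | |];
  rewrite IH; [apply mul_ldiv | apply ldiv_mul].
Qed.

Lemma act_inv_act (Q : leftQuasigroup) (w : list (bool * Q)) z :
  act_inv w (act w z) = z.
Proof.
induction w as [| [[] a] w IH]; simpl; [reflexivity | |];
  [rewrite ldiv_mul | rewrite mul_ldiv]; exact IH.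
Qed.

Lemma eval_act_term (X : Type) (Q : leftQuasigroup) (v : X -> Q) w z :
  eval v (act_term w z) = act (eval_word v w) (eval v z).
Proof.
induction w as [| [[] a] w IH]; simpl; [reflexivity | |]; rewrite IH; reflexivity.
Qed.

Lemma eval_act_inv_term (X : Type) (Q : leftQuasigroup) (v : X -> Q) w z :
  eval v (act_inv_term w z) = act_inv (eval_word v w) (eval v z).
Proof.
revert z; induction w as [| [[] a] w IH]; intro z; simpl; [reflexivity | |];
  rewrite IH; reflexivity.
Qed.

Fixpoint rename {X Y : Type} (s : X -> Y) (t : term X) : term Y :=
  match t with
  | Var x => Var (s x)
  | Mul t u => Mul (rename s t) (rename s u)
  | LDiv t u => LDiv (rename s t) (rename s u)
  end.

Definition rename_word {X Y : Type} (s : X -> Y) (w : list (bool * term X)) :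
  list (bool * term Y) := map (fun l => (fst l, rename s (snd l))) w.

Lemma eval_rename (X Y : Type) (Q : leftQuasigroup) (s : X -> Y) (v : Y -> Q)
  (u : X -> Q) t : (forall x, v (s x) = u x) -> eval v (rename s t) = eval u t.
Proof.
intro H; induction t as [x | t IHt r IHr | t IHt r IHr]; simpl; [apply H | |];
  rewrite IHt, IHr; reflexivity.
Qed.

Lemma eval_rename_word (X Y : Type) (Q : leftQuasigroup) (s : X -> Y) (v : Y -> Q)
  (u : X -> Q) w : (forall x, v (s x) = u x) ->
  eval_word v (rename_word s w) = eval_word u w.
Proof.
intro H; unfold eval_word, rename_word; rewrite map_map; apply map_ext.
intros [e t]; simpl; f_equal; apply eval_rename, H.
Qed.

Lemma generated_act_term (X : Type) (P : leftQuasigroup) (g : X -> P)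
  (w : list (bool * generated_lq g)) (z : generated_lq g) t :
  eval g t = proj1_sig z ->
  exists w', eval g (act_term w' t) = proj1_sig (act w z).
Proof.
intro Ht; induction w as [| [e [a [s Hs]]] w [w' IH]]; [exists nil; exact Ht |].
exists ((e, s) :: w'); destruct e; simpl; rewrite Hs, IH; reflexivity.
Qed.

(** If [y] were outside the orbit of [x], the indicator of that orbit would be a homomorphism onto
    the two-element projection algebra, because left translations and their inverses preserve the
    orbit. *)
Lemma orbits_trivial (V : leftQuasigroup -> Prop) (Q : leftQuasigroup) :
  is_variety V -> ~ V (projection_lq bool) -> V Q ->
  forall x y : Q, exists w, act w x = y.
Proof.
intros hV nV VQ x y; apply NNPP; intro Hy; apply nV.
pose (orb := fun u : Q => exists w, act w x = u).
pose (f := fun u => if excluded_middle_informative (orb u) then true else false).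
assert (orb_mul : forall u a, orb u -> orb (mul a u)).
{ intros u a [w <-]; exists ((true, a) :: w); reflexivity. }
assert (orb_ldiv : forall u a, orb u -> orb (ldiv a u)).
{ intros u a [w <-]; exists ((false, a) :: w); reflexivity. }
assert (f_ext : forall u v, (orb u <-> orb v) -> f u = f v).
{ intros u v E; unfold f.
  destruct (excluded_middle_informative (orb u)),
    (excluded_middle_informative (orb v)); tauto. }
apply (variety_image _ hV Q (projection_lq bool) f); [split | | exact VQ].
- intros a u; apply f_ext; split; [| apply orb_mul].
  intro H; rewrite <- (ldiv_mul a u); apply orb_ldiv, H.
- intros a u; apply f_ext; split; [| apply orb_ldiv].
  intro H; rewrite <- (mul_ldiv a u); apply orb_mul, H.
- assert (Hx : orb x) by (exists nil; reflexivity).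
  intros []; [exists x | exists y]; unfold f.
  + destruct (excluded_middle_informative (orb x)); tauto.
  + destruct (excluded_middle_informative (orb y)); tauto.
Qed.

(** * The Mal'cev term and the equivalences *)

Lemma no_projection_malcev (V : leftQuasigroup -> Prop) :
  is_variety V -> ~ V (projection_lq bool) -> has_malcev_term V.
Proof.
intros hV nV.
destruct (free_valuation V hV bool) as [P [g [VP free]]].
destruct (orbits_trivial V (generated_lq g) hV nV
            (generated_in_variety g V hV VP) (generator g true) (generator g false))
  as [w Hw].
destruct (generated_act_term _ _ g w (generator g true) (Var true) eq_refl)
  as [h Hh].
rewrite Hw in Hh.
(* The relation between the two generators, being an equality of term values under [g], holds
   identically in [V]. *)
assert (id : forall Q : leftQuasigroup, V Q -> forall x y : Q,
  act (eval_word (fun i : bool => if i then x else y) h) x = y).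
{ intros Q VQ x y.
  pose proof (free _ (Var false) Hh Q VQ (fun i : bool => if i then x else y)) as E.
  rewrite eval_act_term in E; exact E. }
exists (act_term (rename_word (fun i : bool => if i then v2 else v3) h)
  (act_inv_term (rename_word (fun _ => v2) h) (Var v1))).
assert (val : forall (Q : leftQuasigroup) (x y z : Q),
  eval3 (act_term (rename_word (fun i : bool => if i then v2 else v3) h)
    (act_inv_term (rename_word (fun _ => v2) h) (Var v1))) x y z
  = act (eval_word (fun i : bool => if i then y else z) h)
      (* The valuation [if i then y else y], rather than a constant function, matches the instance
         of [id] at (y,y) syntactically. *)
      (act_inv (eval_word (fun i : bool => if i then y else y) h) x)).
{ intros Q x y z; unfold eval3; rewrite eval_act_term, eval_act_inv_term.
  f_equal; [| f_equal]; apply eval_rename_word; intros []; reflexivity. }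
intros Q VQ x y; rewrite !val; split; [apply act_act_inv |].
(* From h_{y,y}(y) = y the inverse of h_{y,y} fixes [y], so m(y,y,x) = h_{y,x}(y) = x. *)
pose proof (f_equal (act_inv (eval_word (fun i : bool => if i then y else y) h))
              (id Q VQ y y)) as E.
rewrite act_inv_act in E; rewrite <- E; apply id, VQ.
Qed.

Theorem theorem3p5 (V : leftQuasigroup -> Prop) (hV : is_variety V) :
  (congruence_meet_semidistributive V <-> congruence_distributive V) /\
  (congruence_distributive V <-> congruence_arithmetic V).
Proof.
assert (malcev : congruence_meet_semidistributive V -> has_malcev_term V).
{ intro SD; apply no_projection_malcev; [exact hV |].
  apply meet_semidistributive_no_projection; assumption. }
pose proof (distributive_meet_semidistributive V) as D_SD.
split; split.
- intro SD; apply malcev_meet_semidistributive_distributive; auto.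
- exact D_SD.
- intro D; split; auto.
- intros [D _]; exact D.
Qed.
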